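(* Let $G$ be a finite simple connected graph with at least two vertices. Then $o(G\circ P_{2\ell})=o(G\circ C_{2\ell})=\mathcal{R}$ for every $\ell\ge 3$. Moreover, $R_{\rm MB}(G\circ P_6)=R_{\rm MB}'(G\circ P_6)=3n(G)$.
   Context: $P_n$ and $C_n$ are the path and cycle on $n$ vertices; $n(G)$ is the number of vertices of $G$. The lexicographic product $G\circ H$ has vertex set $V(G)\times V(H)$, with $(g,h)(g',h')$ an edge iff $gg'\in E(G)$, or $g=g'$ and $hh'\in E(H)$. A set $W\subseteq V(X)$ is a resolving set of a connected graph $X$ if for every two distinct vertices $x,y$ there is $z\in W$ with $d(x,z)\ne d(y,z)$. In the Maker-Breaker resolving game on $X$, Resolver and Spoiler alternately select unplayed vertices of $X$; Resolver wins if the vertices he selects contain a resolving set of $X$, and Spoiler wins if she selects at least one vertex of every resolving set of $X$. The R-game has Resolver moving first; the S-game has Spoiler moving first. $o(X)=\mathcal{R}$ means Resolver has a winning strategy no matter who starts. $R_{\rm MB}(X)$ (resp. $R_{\rm MB}'(X)$) is the minimum number of moves Resolver needs to win the R-game (resp. S-game) under optimal play of both players. *)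

(* Defs.v *)
From mathcomp Require Import all_boot.

Set Implicit Arguments.
Unset Strict Implicit.
Unset Printing Implicit Defensive.

(* A graph on the finite vertex set T is its adjacency relation e : rel T. *)

Definition simple_graph (T : finType) (e : rel T) : Prop :=
  symmetric e /\ irreflexive e.

Definition connected_graph (T : finType) (e : rel T) : Prop :=
  forall x y : T, connect e x y.

Definition path_graph (n : nat) : rel 'I_n :=
  fun i j => (i.+1 == j :> nat) || (j.+1 == i :> nat).
Arguments path_graph : clear implicits.

(* [ordS] is the cyclic successor, so this is the n-cycle for n >= 3. *)
Definition cycle_graph (n : nat) : rel 'I_n :=
  fun i j => (ordS i == j) || (ordS j == i).
Arguments cycle_graph : clear implicits.

Definition lex_product (V U : finType) (e : rel V) (f : rel U) : rel (V * U) :=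
  fun x y => e x.1 y.1 || ((x.1 == y.1) && f x.2 y.2).

Definition has_walk (T : finType) (e : rel T) (x y : T) (n : nat) : bool :=
  [exists p : n.-tuple T, path e x p && (last x p == y)].

(* The least length of a walk from x to y.  Shortest walks have length less
   than #|T|; the value is #|T| when y is not reachable from x. *)
Definition dist (T : finType) (e : rel T) (x y : T) : nat :=
  find (has_walk e x y) (iota 0 #|T|).

Definition resolving (T : finType) (e : rel T) (W : {set T}) : bool :=
  [forall x, forall y, (x != y) ==> [exists z in W, dist e x z != dist e y z]].

Definition contains_resolving (T : finType) (e : rel T) (A : {set T}) : bool :=
  [exists W : {set T}, (W \subset A) && resolving e W].

Variant player := Resolver | Spoiler.

Definition opponent (w : player) : player :=
  if w is Resolver then Spoiler else Resolver.

(* Who makes the move of index i (counted from 0) when w moves first. *)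
Definition mover (w : player) (i : nat) : player := iter i opponent w.

(* A play is the sequence, in chronological order, of the vertices selected by
   both players.  It goes on until the board is full: this does not affect who
   wins, since both winning conditions persist once they hold and exactly one
   of them holds on a full board. *)
Definition complete_play (T : finType) (p : seq T) : Prop :=
  uniq p /\ size p = #|T|.

Fixpoint resolver_moves (T : finType) (w : player) (p : seq T) : seq T :=
  if p is x :: p' then
    let r := resolver_moves (opponent w) p' in
    if w is Resolver then x :: r else r
  else [::].

(* A strategy maps the history of the play to the next vertex to select. *)
Definition strategy (T : finType) := seq T -> T.

Definition legal (T : finType) (s : strategy T) : Prop :=
  forall h : seq T, uniq h -> size h < #|T| -> s h \notin h.

Definition resolver_follows (T : finType) (w : player) (s : strategy T)
    (p : seq T) : Prop :=
  forall (h : seq T) (x : T),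
    prefix (rcons h x) p -> mover w (size h) = Resolver -> x = s h.

Definition resolver_winning_strategy (T : finType) (e : rel T) (w : player)
    (s : strategy T) : Prop :=
  legal s /\
  forall p : seq T, complete_play p -> resolver_follows w s p ->
    contains_resolving e [set x in resolver_moves w p].

(* o(X) = R *)
Definition outcome_R (T : finType) (e : rel T) : Prop :=
  forall w : player, exists s : strategy T, resolver_winning_strategy e w s.

(* Playing s, Resolver has always won after at most k moves of his own. *)
Definition wins_within (T : finType) (e : rel T) (w : player)
    (s : strategy T) (k : nat) : Prop :=
  legal s /\
  forall p : seq T, complete_play p -> resolver_follows w s p ->
    contains_resolving e [set x in take k (resolver_moves w p)].

Definition is_min (P : nat -> Prop) (k : nat) : Prop :=
  P k /\ forall j : nat, P j -> k <= j.

(* [is_game_length e w k]: under optimal play, k is the number of moves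
   Resolver needs to win the game in which w moves first.  It holds for no k
   when Resolver has no winning strategy. *)
Definition is_game_length (T : finType) (e : rel T) (w : player) (k : nat)
    : Prop :=
  is_min (fun j => exists s : strategy T, wins_within e w s j) k.

(* R_MB(X) = k *)
Definition R_MB_is (T : finType) (e : rel T) (k : nat) : Prop :=
  is_game_length e Resolver k.

(* R'_MB(X) = k *)
Definition R_MB'_is (T : finType) (e : rel T) (k : nat) : Prop :=
  is_game_length e Spoiler k.

(* Main.v *)
Require Import Defs.
From mathcomp Require Import all_boot zify.

(* Split H = P_2l or C_2l into the edges {2i, 2i+1}.  Any set meeting every copy
   of these edges in every layer of G o H resolves G o H: in each layer it is
   dominating, it is contained in no neighborhood, and it tells apart the
   vertices of the layer since H has no 4-cycle.  Resolver wins by the pairing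
   strategy on these edges.  In a layer P_6 = 0-1-2-3-4-5 the only pairs that
   tell its vertices apart are {1, 3} and {2, 4}, so by playing the pairing
   strategy on {1, 3}, {2, 4}, {0, 5} Spoiler forces Resolver to select three
   vertices in each layer; three per layer is all that Resolver ever gets. *)

Set Implicit Arguments.
Unset Strict Implicit.
Unset Printing Implicit Defensive.

(** * Walks and small distances *)

Section Distance.

Variables (T : finType) (e : rel T).
Implicit Types x y z : T.

Lemma has_walkP x y n :
  reflect (exists p, [/\ size p = n, path e x p & last x p = y])
          (has_walk e x y n).
Proof.
apply: (iffP existsP) => [[p /andP[ep /eqP lp]]|[p [sp ep lp]]].
  by exists p; rewrite size_tuple.
by move/eqP: sp => sp; exists (Tuple sp); rewrite /= ep lp eqxx.
Qed.

Lemma has_walk0 x y : has_walk e x y 0 = (x == y).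
Proof.
apply/has_walkP/eqP => [[p [/size0nil -> _ <-]] //|->].
by exists [::].
Qed.

Lemma has_walk1 x y : has_walk e x y 1 = e x y.
Proof.
apply/has_walkP/idP => [[[|a [|b p]] [//= _ /andP[ea _] <-]] //|exy].
by exists [:: y]; rewrite /= exy.
Qed.

Lemma has_walk2 x y z : e x z -> e z y -> has_walk e x y 2.
Proof.
by move=> exz ezy; apply/has_walkP; exists [:: z; y]; rewrite /= exz ezy.
Qed.

Lemma dist_eq0 x y : (dist e x y == 0) = (x == y).
Proof.
rewrite /dist; have : 0 < #|T| by apply/card_gt0P; exists x.
by case: #|T| => // n _ /=; rewrite has_walk0; case: (x == y).
Qed.

Lemma dist_eq1 x y : (dist e x y == 1) = (x != y) && e x y.
Proof.
have [<-|nxy] /= := eqVneq x y.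
  by have := dist_eq0 x x; rewrite eqxx => /eqP ->.
have : 2 <= #|T|.
  by have := max_card (mem [:: x; y]); rewrite (card_uniqP _) //= inE nxy.
rewrite /dist; case: #|T| => [|[|n]] // _ /=.
by rewrite has_walk0 (negPf nxy) has_walk1; case: (e x y).
Qed.

Lemma dist_eq2 x y z :
  x != y -> ~~ e x y -> e x z -> e z y -> dist e x y = 2.
Proof.
move=> nxy nexy exz ezy.
have nxz : x != z by apply: contraNneq nexy => ->.
have nyz : y != z by apply: contraNneq nexy => ->.
(* [dist] tries only lengths below [#|T|]; since [x], [y] and [z] are distinct, length 2 is among
   them. *)
have : 3 <= #|T|.
  have := max_card (mem [:: x; y; z]).
  by rewrite (card_uniqP _) //= !inE (negPf nxy) (negPf nxz) nyz.
rewrite /dist; case: #|T| => [|[|[|n]]] // _ /=.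
by rewrite has_walk0 (negPf nxy) has_walk1 (negPf nexy) (has_walk2 exz ezy).
Qed.

(** Distances are compared through arbitrary walks, without handling shortest paths. If no walk from
    [x] is found, its distance is the default [#|T|], which bounds every distance. *)
Lemma dist_le x y z :
  (forall n, has_walk e x z n -> exists2 m, m <= n & has_walk e y z m) ->
  dist e y z <= dist e x z.
Proof.
move=> walk; have [has_w|no_w] := boolP (has (has_walk e x z) (iota 0 #|T|)).
  have := nth_find 0 has_w; rewrite -/(dist e x z); move: (has_w).
  rewrite has_find size_iota -/(dist e x z) => ltT; rewrite nth_iota // add0n.
  case/walk=> m le_m wm; apply: leq_trans le_m; rewrite leqNgt; apply/negP => lt_m.
  have := before_find 0 lt_m; rewrite nth_iota ?add0n ?wm //.
  by apply: leq_trans lt_m _; rewrite -[X in _ <= X](size_iota 0) find_size.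
by rewrite {2}/dist (hasNfind no_w) /dist find_size.
Qed.

End Distance.

(** * Distances and resolving sets in a lexicographic product *)

Section LexProduct.

Variables (V U : finType) (e : rel V) (f : rel U).
Local Notation lex := (lex_product e f).

(* A walk may wander inside the starting fiber; everything before it first
   leaves that fiber can be cut, after which only the fiber matters. *)
Lemma dist_lex_fiber_le g g' u u' v :
  g != g' -> dist lex (g, u') (g', v) <= dist lex (g, u) (g', v).
Proof.
move=> ngg'; apply: dist_le => n /has_walkP[p [<- {n}]].
elim: p u => [|[g1 u1] p IHp] u /= => [_ [gg']|]; first by rewrite gg' eqxx in ngg'.
case/andP; rewrite {1}/lex_product /=.
have [<- _|ng1 /= ] := eqVneq g g1.
  move=> ep lp; have [m le_m wm] := IHp u1 ep lp.
  by exists m => //; apply: leqW.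
rewrite orbF => eg1 ep lp; exists (size p).+1 => //; apply/has_walkP.
by exists ((g1, u1) :: p); rewrite /= ep {1}/lex_product /= eg1.
Qed.

(** Hence two vertices of a fiber can be told apart only by a vertex of that fiber. *)
Lemma dist_lex_fiber g g' u u' v :
  g != g' -> dist lex (g, u') (g', v) = dist lex (g, u) (g', v).
Proof. by move=> ngg'; apply/eqP; rewrite eqn_leq !dist_lex_fiber_le. Qed.

Hypothesis e_irr : irreflexive e.

Lemma lex_in_fiber g u v : lex (g, u) (g, v) = f u v.
Proof. by rewrite /lex_product /= e_irr eqxx. Qed.

(** Nonadjacent vertices of a fiber have a common neighbor in the fiber of [k], so distances are cut
    off at 2. *)
Lemma dist_lex_in_fiber g k u v : e g k -> e k g ->
  dist lex (g, u) (g, v) = if u == v then 0 else if f u v then 1 else 2.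
Proof.
move=> egk ekg; have [->|nuv] := eqVneq u v.
  by apply/eqP; rewrite dist_eq0.
have nguv : (g, u) != (g, v) by rewrite xpair_eqE eqxx.
case: ifP => fuv; first by apply/eqP; rewrite dist_eq1 nguv lex_in_fiber fuv.
apply: (@dist_eq2 _ _ _ _ (k, u)) => //; first by rewrite lex_in_fiber fuv.
  by rewrite /lex_product /= egk.
by rewrite /lex_product /= ekg.
Qed.

(** [m] is meant as the mate map of a perfect matching of [f]. By [f_far], each neighborhood misses
    a whole matching edge, so it contains no set meeting them all. *)
Variable m : U -> U.
Hypotheses (f_sym : symmetric f) (mK : involutive m)
  (f_m : forall u, f u (m u))
  (f_C4free : forall a b c d, f a b -> f b c -> f c d -> f d a -> a = c \/ b = d)
  (f_far : forall u, exists2 v, ~~ f u v & ~~ f u (m v)).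

(* Vertices in distinct fibers at distance 1 are told apart by a selected
   vertex not adjacent to the first one, those at larger distance by a selected
   vertex dominating it.  Two unselected vertices of a fiber not told apart by
   their selected mates would form a 4-cycle with them. *)
Lemma transversal_resolving (W : {set V * U}) :
  (forall g u, ((g, u) \in W) || ((g, m u) \in W)) -> resolving lex W.
Proof.
move=> Wm; apply/forallP => -[g u]; apply/forallP => -[g' u']; apply/implyP => nx.
apply/existsP; have [eg|ngg'] := eqVneq g g'.
  rewrite -{g'}eg in nx *.
  have nuu' : u != u' by move: nx; rewrite xpair_eqE eqxx.
  have [Wu|nWu] := boolP ((g, u) \in W).
    exists (g, u); rewrite Wu; apply/negP => /eqP eqd.
    have := dist_eq0 lex (g, u') (g, u).
    by rewrite -eqd dist_eq0 eqxx eq_sym (negPf nx).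
  have [Wu'|nWu'] := boolP ((g, u') \in W).
    exists (g, u'); rewrite Wu'; apply/negP => /eqP eqd.
    have := dist_eq0 lex (g, u) (g, u').
    by rewrite eqd dist_eq0 eqxx (negPf nx).
  have Wmu : (g, m u) \in W by have := Wm g u; rewrite (negPf nWu).
  have Wmu' : (g, m u') \in W by have := Wm g u'; rewrite (negPf nWu').
  have neq a b : (g, a) \notin W -> (g, b) \in W -> (g, a) != (g, b).
    by move=> na; apply: contraTneq => <-.
  have [fu'|nfu'] := boolP (f u' (m u)); last first.
    exists (g, m u); rewrite Wmu; apply/negP => /eqP eqd.
    have := dist_eq1 lex (g, u) (g, m u).
    by rewrite eqd !dist_eq1 !neq //= !lex_in_fiber f_m (negPf nfu').
  have [fu|nfu] := boolP (f u (m u')); last first.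
    exists (g, m u'); rewrite Wmu'; apply/negP => /eqP eqd.
    have := dist_eq1 lex (g, u) (g, m u').
    by rewrite eqd !dist_eq1 !neq //= !lex_in_fiber f_m (negPf nfu).
  have := f_C4free (f_m u) _ (f_m u') _.
  rewrite f_sym fu' f_sym fu => /(_ isT isT)[uu'|/(can_inj mK) uu'];
    by rewrite uu' eqxx in nuu'.
have ng'g : g' != g by rewrite eq_sym.
have neq v : (g', u') != (g, v) by rewrite xpair_eqE (negPf ng'g).
have [eg'g|neg'g] := boolP (e g' g).
  have d1 v : dist lex (g', u') (g, v) == 1.
    by rewrite dist_eq1 neq /lex_product /= eg'g.
  have [v nfv nfmv] := f_far u.
  have [w Ww nfw] : exists2 w, (g, w) \in W & ~~ f u w.
    by case/orP: (Wm g v) => ?; [exists v | exists (m v)].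
  exists (g, w); rewrite Ww (eqP (d1 w)) dist_eq1 lex_in_fiber (negPf nfw).
  by rewrite andbF.
have [w Ww dw] : exists2 w, (g, w) \in W & (u == w) || f u w.
  by case/orP: (Wm g u) => ?; [exists u | exists (m u)]; rewrite ?eqxx ?f_m ?orbT.
exists (g, w); rewrite Ww; apply/negP => /eqP eqd.
have := dist_eq1 lex (g', u') (g, w); have := dist_eq0 lex (g', u') (g, w).
rewrite -eqd dist_eq0 dist_eq1 lex_in_fiber (negPf (neq w)) => -> /=.
rewrite /lex_product /= (negPf neg'g) (negPf ng'g) /= => nfuw.
have := dist_eq0 lex (g', u') (g, w).
rewrite -eqd dist_eq0 (negPf (neq w)) xpair_eqE eqxx /= => nuw.
by rewrite nuw nfuw in dw.
Qed.

End LexProduct.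

(** * Plays and pairing strategies *)

Section Games.

Variable T : finType.
Implicit Types (p h : seq T) (s : strategy T) (w a : player).

Lemma opponentK : involutive opponent. Proof. by case. Qed.

Lemma moverS w i : mover w i.+1 = opponent (mover w i).
Proof. by []. Qed.

Lemma mover_opponent w i : mover (opponent w) i = mover w i.+1.
Proof. by rewrite /mover iterSr. Qed.

(** For [a := Resolver] this is [resolver_follows]; a general [a] lets one pairing argument serve
    both players. *)
Definition follows a w s p :=
  forall h x, prefix (rcons h x) p -> mover w (size h) = a -> x = s h.

Lemma nth_resolver_moves x0 w p i :
  i < size p -> mover w i = Resolver -> nth x0 p i \in resolver_moves w p.
Proof.
elim: p w i => //= x p IHp w [_ /= ->|i lti]; first by rewrite inE eqxx.
rewrite -mover_opponent => /(IHp _ _ lti).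
by case: w => //= ?; rewrite inE orbC; apply/orP; left.
Qed.

Lemma resolver_movesP x0 w p x : x \in resolver_moves w p ->
  exists2 i, i < size p & mover w i = Resolver /\ nth x0 p i = x.
Proof.
elim: p w => //= y p IHp w.
have rest : x \in resolver_moves (opponent w) p ->
    exists2 i, i < (size p).+1 & mover w i = Resolver /\ nth x0 (y :: p) i = x.
  by case/IHp => i lti [mi xi]; exists i.+1 => //; rewrite -mover_opponent.
by case: w rest => //= rest; rewrite inE => /orP[/eqP ->|//]; exists 0.
Qed.

Lemma size_resolver_moves w p : ~~ odd (size p) ->
  size (resolver_moves w p) = (size p)./2.
Proof.
have [n] := ubnP (size p); elim: n p => // n IHn [|x [|y p]] //= lt_n.
by rewrite negbK => op; case: w IHn => /= ->; lia.
Qed.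

Section Pairing.

Variables (x0 : T) (m : T -> T).

(** On the player's turn, the last move in [h] is the opponent's, unless [h] is empty: then [x0]
    stands in for it, and the opening move is [m x0]. *)
Definition pairing_strategy : strategy T := fun h =>
  if m (last x0 h) \notin h then m (last x0 h) else odflt x0 [pick z | z \notin h].

Lemma pairing_strategy_legal : legal pairing_strategy.
Proof.
move=> h uh szh; rewrite /pairing_strategy; case: ifP => // _.
case: pickP => //= all_h; suff : #|T| <= size h by rewrite leqNgt szh.
rewrite -(card_uniqP uh); apply/subset_leq_card/subsetP => z _.
by have := all_h z; case: (z \in h).
Qed.

(** Move [i.+1] is the reply of [a] to move [i]. If the mate were played only at [j], it would have
    been free then, and the strategy would have taken it. *)
Lemma pairing_strategy_lt a w p i j : uniq p ->
  follows a w pairing_strategy p -> i < j -> j < size p ->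
  mover w i = opponent a -> mover w j = opponent a ->
  nth x0 p j <> m (nth x0 p i).
Proof.
move=> up fp ltij ltj mi mj pj.
have mi1 : mover w i.+1 = a by rewrite moverS mi opponentK.
have lti1j : i.+1 < j.
  rewrite ltn_neqAle ltij andbT; apply/eqP => ij.
  by move: mj; rewrite -ij mi1; case: (a).
have lti1 : i.+1 < size p := ltn_trans lti1j ltj.
have szh : size (take i.+1 p) = i.+1 by rewrite size_takel // ltnW.
have lasth : last x0 (take i.+1 p) = nth x0 p i.
  by rewrite -nth_last szh nth_take.
have := fp (take i.+1 p) (nth x0 p i.+1).
rewrite szh -take_nth // => /(_ (prefix_take _ _) mi1).
rewrite /pairing_strategy lasth -pj ifT => [/eqP|].
  by rewrite nth_uniq // ltn_eqF.
apply/negP => /(nthP x0)[k]; rewrite szh => ltk; rewrite nth_take // => /eqP.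
by rewrite nth_uniq ?(ltn_trans ltk) // => /eqP kj; rewrite kj ltnNge ltnW in ltk.
Qed.

Hypotheses (mK : involutive m) (m_neq : forall x, m x != x).

Lemma pairing_strategy_split a w p i j : uniq p ->
  follows a w pairing_strategy p -> i < size p -> j < size p ->
  mover w i = opponent a -> mover w j = opponent a ->
  nth x0 p j <> m (nth x0 p i).
Proof.
move=> up fp lti ltj mi mj pj; have [lij|lji|eij] := ltngtP i j.
- exact: (pairing_strategy_lt up fp lij ltj mi mj pj).
- by apply: (pairing_strategy_lt up fp lji lti mj mi); rewrite pj mK.
- by have := m_neq (nth x0 p i); rewrite -pj eij eqxx.
Qed.

(** A complete play exhausts the board, so a pair missed by Resolver would belong wholly to
    Spoiler. *)
Lemma pairing_strategy_resolver w p x : complete_play p ->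
  resolver_follows w pairing_strategy p ->
  (x \in resolver_moves w p) || (m x \in resolver_moves w p).
Proof.
move=> [up szp] fp.
have in_p y : y \in p.
  apply: contraT => ny; have := max_card (mem (y :: p)).
  by rewrite (card_uniqP _) /= ?ny ?up // szp ltnn.
have lt y : index y p < size p by rewrite index_mem.
case mx: (mover w (index x p)).
  by have := nth_resolver_moves x0 (lt x) mx; rewrite nth_index // => ->.
case mmx: (mover w (index (m x) p)).
  by have := nth_resolver_moves x0 (lt (m x)) mmx; rewrite nth_index // orbC => ->.
by have := pairing_strategy_split up fp (lt x) (lt (m x)) mx mmx; rewrite !nth_index.
Qed.

Lemma pairing_strategy_spoiler w p x : uniq p ->
  follows Spoiler w pairing_strategy p ->
  x \in resolver_moves w p -> m x \notin resolver_moves w p.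
Proof.
move=> up fp /(resolver_movesP x0)[i lti [mi xi]].
apply/negP => /(resolver_movesP x0)[j ltj [mj xj]].
by apply: (pairing_strategy_split up fp lti ltj mi mj); rewrite xi.
Qed.

End Pairing.

(** Needed for the lower bound, where a given strategy of Resolver must actually meet one of
    Spoiler. *)
Lemma play_exists w (sR sS : strategy T) : legal sR -> legal sS ->
  exists p, [/\ complete_play p, resolver_follows w sR p & follows Spoiler w sS p].
Proof.
move=> legR legS.
pose s h := if mover w (size h) is Resolver then sR h else sS h.
have leg : legal s by move=> h uh sh; rewrite /s; case: mover; [apply: legR | apply: legS].
have play n : n <= #|T| -> exists p, [/\ uniq p, size p = n &
    forall h x, prefix (rcons h x) p -> x = s h].
  elim: n => [|n IHn] ltn; first by exists [::]; split=> // -[|? ?] ?.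
  have [p [up sp fp]] := IHn (ltnW ltn); exists (rcons p (s p)); split.
  - by rewrite rcons_uniq up andbT leg // sp.
  - by rewrite size_rcons sp.
  move=> h x /prefixP[t]; case/lastP: t => [|t y].
    by rewrite cats0 => /rcons_inj[-> ->].
  by rewrite -rcons_cat => /rcons_inj[pE _]; apply: fp; rewrite pE prefix_prefix.
have [p [up sp fp]] := play _ (leqnn _); exists p; split=> // h x hx mh;
  by rewrite (fp _ _ hx) /s mh.
Qed.

End Games.

(** * Resolver's win for even paths and cycles *)

Lemma lex_product_outcome (V U : finType) (e : rel V) (f : rel U) (m : U -> U)
    (x0 : V * U) :
  irreflexive e -> irreflexive f -> symmetric f -> involutive m ->
  (forall u, f u (m u)) ->
  (forall a b c d, f a b -> f b c -> f c d -> f d a -> a = c \/ b = d) ->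
  (forall u, exists2 v, ~~ f u v & ~~ f u (m v)) ->
  outcome_R (lex_product e f).
Proof.
move=> e_irr f_irr f_sym mK f_m f_C4 f_far w.
pose mm (x : V * U) := (x.1, m x.2).
have mmK : involutive mm by move=> [g u]; rewrite /mm /= mK.
have mm_neq x : mm x != x.
  case: x => g u; rewrite xpair_eqE eqxx /=; apply/negP => /eqP mu.
  by have := f_m u; rewrite mu f_irr.
exists (pairing_strategy x0 mm); split; first exact: pairing_strategy_legal.
move=> p cp fp; apply/existsP; exists [set x in resolver_moves w p].
rewrite subxx; apply: (transversal_resolving e_irr f_sym mK f_m f_C4 f_far).
by move=> g u; rewrite !inE (pairing_strategy_resolver mmK mm_neq (g, u) cp fp).
Qed.

Definition even_odd_mate (i : nat) : nat := if odd i then i.-1 else i.+1.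

Lemma even_odd_mate_lt l (i : 'I_(2 * l)) : even_odd_mate i < 2 * l.
Proof. by have := ltn_ord i; rewrite /even_odd_mate; case: ifP; lia. Qed.

Definition ord_mate l (i : 'I_(2 * l)) : 'I_(2 * l) := Ordinal (even_odd_mate_lt i).

Lemma ord_mateK l : involutive (@ord_mate l).
Proof.
move=> i; apply: val_inj; rewrite /= /even_odd_mate.
by case: (boolP (odd i)) => oi; case: ifP; lia.
Qed.

Lemma path_graph_ord_mate l (i : 'I_(2 * l)) : path_graph (2 * l) i (ord_mate i).
Proof. by rewrite /path_graph /= /even_odd_mate; case: ifP; lia. Qed.

Lemma path_graph_sym n : symmetric (path_graph n).
Proof. by move=> i j; rewrite /path_graph orbC. Qed.

Lemma path_graph_irr n : irreflexive (path_graph n).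
Proof. by move=> i; rewrite /path_graph; lia. Qed.

Lemma cycle_graph_sym n : symmetric (cycle_graph n).
Proof. by move=> i j; rewrite /cycle_graph orbC. Qed.

(** Replaces the modular successor by linear arithmetic, within reach of [lia]. *)
Lemma cycle_graphE n (i j : 'I_n) : cycle_graph n i j =
  [|| i.+1 == j, j.+1 == i, (i.+1 == n) && (j == 0 :> nat)
    | (j.+1 == n) && (i == 0 :> nat)].
Proof.
have ordSE (k k' : 'I_n) :
    (ordS k == k') = (k.+1 == k' :> nat) || (k.+1 == n) && (k' == 0 :> nat).
  rewrite -val_eqE /=; have := ltn_ord k; have := ltn_ord k'.
  have [->|nk] := eqVneq k.+1 n; first by rewrite modnn; lia.
  by move=> ? ?; rewrite modn_small; lia.
by rewrite /cycle_graph !ordSE; lia.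
Qed.

Lemma cycle_graph_irr n : 1 < n -> irreflexive (cycle_graph n).
Proof. by move=> n_gt1 i; rewrite cycle_graphE; lia. Qed.

(** Adjacency of mates passes up to the cycle, while absence of 4-cycles and existence of far pairs
    pass down to the path, so each is proved only once. *)
Lemma path_sub_cycle n : subrel (path_graph n) (cycle_graph n).
Proof. by move=> i j; rewrite cycle_graphE /path_graph; lia. Qed.

Lemma cycle_graph_C4free n : 4 < n -> forall a b c d,
  cycle_graph n a b -> cycle_graph n b c -> cycle_graph n c d ->
  cycle_graph n d a -> a = c \/ b = d.
Proof.
move=> n_gt4 a b c d; rewrite !cycle_graphE => ab bc cd da.
have [ac|nac] := eqVneq (a : nat) c; first by left; apply: val_inj.
by right; apply: val_inj; rewrite /=; move: ab bc cd da nac; lia.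
Qed.

(* A vertex has a single neighbor besides its mate, hence no neighbor in at
   least one of the two adjacent pairs. *)
Lemma cycle_graph_far l : 2 < l -> forall u : 'I_(2 * l), exists2 v,
  ~~ cycle_graph (2 * l) u v & ~~ cycle_graph (2 * l) u (ord_mate v).
Proof.
move=> l_gt2 u; have ltu := ltn_ord u.
(* The pair of [k] is, cyclically, next to the pair of [u] on the side of the mate of [u]. The other
   neighbor of [u] lies in the pair on the opposite side, a different one since [l > 2]. *)
pose k := if odd u then (if u == 1 :> nat then 2 * l - 1 else u - 2)
  else if u.+2 == 2 * l then 0 else u.+2.
have kE : odd u /\ ((u = 1 :> nat /\ k = 2 * l - 1) \/ (1 < u /\ k = u - 2)) \/
    ~~ odd u /\ ((u.+2 = 2 * l /\ k = 0) \/ (u.+2 < 2 * l /\ k = u.+2)).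
  by rewrite /k; case: (boolP (odd u)) => ou; case: eqP => eu; lia.
have ltk : k < 2 * l by lia.
by exists (Ordinal ltk); rewrite cycle_graphE /= ?/even_odd_mate; try case: ifP;
  move: (k) kE; lia.
Qed.

Lemma lex_path_cycle_outcome (V : finType) (e : rel V) l :
  irreflexive e -> 0 < #|V| -> 2 < l ->
  outcome_R (lex_product e (path_graph (2 * l))) /\
  outcome_R (lex_product e (cycle_graph (2 * l))).
Proof.
move=> e_irr /card_gt0P[g _] l_gt2.
have l_gt0 : 0 < 2 * l by lia.
have sub := @path_sub_cycle (2 * l).
split; apply: (@lex_product_outcome _ _ _ _ (@ord_mate l) (g, Ordinal l_gt0)) => //.
- exact: path_graph_irr.
- exact: path_graph_sym.
- exact: ord_mateK.
- exact: path_graph_ord_mate.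
- move=> a b c d /sub ab /sub bc /sub cd /sub da.
  by apply: (cycle_graph_C4free _ ab bc cd da); lia.
- move=> u; have [v nv nmv] := cycle_graph_far l_gt2 u.
  by exists v; [apply: contra nv | apply: contra nmv]; apply: sub.
- by apply: cycle_graph_irr; lia.
- exact: cycle_graph_sym.
- exact: ord_mateK.
- by move=> u; apply/sub/path_graph_ord_mate.
- by apply: cycle_graph_C4free; lia.
- exact: cycle_graph_far.
Qed.

(** * Spoiler's pairing and the game length for the path on six vertices *)

Definition P6_mate (i : 'I_6) : 'I_6 := inord (nth 0 [:: 5; 3; 4; 1; 2; 0] i).

Lemma P6_mateE i : P6_mate i = nth 0 [:: 5; 3; 4; 1; 2; 0] i :> nat.
Proof. by rewrite inordK //; case: i => [[|[|[|[|[|[|]]]]]]]. Qed.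

Lemma P6_mateK : involutive P6_mate.
Proof.
by move=> i; apply: val_inj; rewrite /= !P6_mateE; case: i => [[|[|[|[|[|[|]]]]]]].
Qed.

Lemma P6_mate_neq i : P6_mate i != i.
Proof. by rewrite -val_eqE /= P6_mateE; case: i => [[|[|[|[|[|[|]]]]]]]. Qed.

(** The distance inside a fiber, as given by [dist_lex_in_fiber]; it is put on numbers so that it
    computes. *)
Definition P6_dist (u v : nat) : nat :=
  if u == v then 0 else if (u.+1 == v) || (v.+1 == u) then 1 else 2.

(** A finite check by computation; the case [a = b] is included and covers singletons. *)
Lemma P6_pair_not_resolving (a b : 'I_6) : b != P6_mate a ->
  exists u v : 'I_6, [/\ u != v, P6_dist u a = P6_dist v a
                         & P6_dist u b = P6_dist v b].
Proof.
rewrite -val_eqE /= P6_mateE => nba.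
have /allP/(_ a) : all (fun a => all (fun b => (b != nth 0 [:: 5; 3; 4; 1; 2; 0] a) ==>
  has (fun u => has (fun v => [&& u != v, P6_dist u a == P6_dist v a
    & P6_dist u b == P6_dist v b]) (iota 0 6)) (iota 0 6)) (iota 0 6)) (iota 0 6).
  by vm_compute.
rewrite mem_iota ltn_ord => /(_ isT)/allP/(_ b).
rewrite mem_iota ltn_ord => /(_ isT)/implyP/(_ nba)/hasP[u].
rewrite mem_iota => ltu /hasP[v]; rewrite mem_iota => ltv /and3P[nuv /eqP ua /eqP ub].
by exists (Ordinal ltu), (Ordinal ltv).
Qed.

Lemma P6_resolving_card (A : {set 'I_6}) :
  (forall u, u \in A -> P6_mate u \notin A) ->
  (forall u v : 'I_6, u != v -> exists2 a, a \in A & P6_dist u a != P6_dist v a) ->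
  2 < #|A|.
Proof.
move=> Amate Ares; rewrite ltnNge; apply/negP => cardA.
have [a [b [nba Aab]]] : exists a b : 'I_6,
    b != P6_mate a /\ forall x, x \in A -> x = a \/ x = b.
  have inA x : x \in A = (x \in enum A) by rewrite mem_enum.
  have neq x : x != P6_mate x by rewrite eq_sym P6_mate_neq.
  move: cardA inA; rewrite cardE; case: (enum A) => [|a [|b [|//]]] _ inA.
  (* Smaller sets are treated as pairs with [a = b], which is allowed because [P6_mate] has no fixed
     point; [ord0] is arbitrary. *)
  - by exists ord0, ord0; split=> // x; rewrite inA.
  - by exists a, a; split=> // x; rewrite inA inE => /eqP; left.
  exists a, b; split=> [|x]; last by rewrite inA !inE => /orP[]/eqP; auto.
  apply: contraNneq (Amate a _) => [<-|]; by rewrite inA !inE eqxx ?orbT.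
have [u [v [nuv ua ub]]] := P6_pair_not_resolving nba.
have [x Ax] := Ares u v nuv.
by case: (Aab x Ax) => ->; rewrite ?ua ?ub eqxx.
Qed.

Lemma connected_neighbor (V : finType) (e : rel V) (g : V) :
  connected_graph e -> 2 <= #|V| -> exists k, e g k.
Proof.
move=> e_conn V_ge2.
have [h nhg] : exists h, h != g.
  have : 0 < #|[set~ g]| by rewrite cardsC1; lia.
  by case/card_gt0P => h; rewrite !inE => nhg; exists h.
have /connectP[[|k p] /=] := e_conn g h; first by move=> _ hg; rewrite hg eqxx in nhg.
by case/andP => egk _ _; exists k.
Qed.

Lemma card_fibers (V U : finType) (A : {set V * U}) :
  #|A| = \sum_g #|[set u | (g, u) \in A]|.
Proof.
rewrite -sum1_card; under [RHS]eq_bigr do rewrite -sum1_card.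
by rewrite pair_big_dep /=; apply: eq_bigl => -[g u]; rewrite inE.
Qed.

(** Vertices of a fiber are separated only from within it, so each fiber of [A] has at least three
    vertices; the bound is the sum over [g]. *)
Lemma lex_P6_resolving_card (V : finType) (e : rel V) (A : {set V * 'I_6}) :
  simple_graph e -> connected_graph e -> 2 <= #|V| ->
  (forall g u, (g, u) \in A -> (g, P6_mate u) \notin A) ->
  contains_resolving (lex_product e (path_graph 6)) A -> 3 * #|V| <= #|A|.
Proof.
move=> [e_sym e_irr] e_conn V_ge2 Amate /existsP[W /andP[/subsetP sWA /forallP resW]].
rewrite card_fibers mulnC -sum_nat_const; apply: leq_sum => g _.
apply: P6_resolving_card => [u|u v nuv]; first by rewrite !inE; apply: Amate.
have nguv : (g, u) != (g, v) by rewrite xpair_eqE eqxx.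
have /forallP/(_ (g, v)) := resW (g, u); rewrite nguv => /existsP[[g' a] /andP[]].
have [<- Wa|ng _] := eqVneq g g'; last by rewrite (dist_lex_fiber _ _ v) ?eqxx.
have [k egk] := connected_neighbor g e_conn V_ge2.
rewrite !(@dist_lex_in_fiber _ _ _ _ _ _ k) // 1?e_sym // => ne.
by exists a; rewrite ?inE ?sWA.
Qed.

Lemma lex_P6_game_length (V : finType) (e : rel V) (w : player) :
  simple_graph e -> connected_graph e -> 2 <= #|V| ->
  is_game_length (lex_product e (path_graph 6)) w (3 * #|V|).
Proof.
move=> e_simple e_conn V_ge2; have [_ e_irr] := e_simple.
have V_gt0 : 0 < #|V| by apply: ltnW.
have cardT : #|{: V * 'I_6}| = (3 * #|V|).*2 by rewrite card_prod card_ord; lia.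
have [outP _] := @lex_path_cycle_outcome V e 3 e_irr V_gt0 isT.
split=> [|j [s [legs wins]]].
  (* Upper bound: on a board of even size Resolver makes exactly half of the moves whoever starts,
     so [take] discards nothing. *)
  have [s [legs wins]] := outP w; exists s; split=> // p cp fp.
  have [_ szp] := cp; rewrite take_oversize ?wins //.
  by rewrite size_resolver_moves szp cardT ?odd_double ?doubleK.
(* Lower bound: the assumed strategy [s] is played against Spoiler's pairing within each fiber. *)
have [g _] := card_gt0P V_gt0.
pose m (x : V * 'I_6) := (x.1, P6_mate x.2).
have mK : involutive m by move=> [h u]; rewrite /m /= P6_mateK.
have m_neq x : m x != x by case: x => h u; rewrite xpair_eqE eqxx P6_mate_neq.
have [p [cp fR fS]] :=
  play_exists w legs (@pairing_strategy_legal _ (g, ord0) m).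
have := lex_P6_resolving_card e_simple e_conn V_ge2 _ (wins p cp fR).
(* [A] holds the first [j] moves of Resolver; as a part of all his moves, it contains no whole
   pair. *)
set A := [set x in _]; move=> card_le; have cardA : #|A| <= j.
  by rewrite cardsE; apply: leq_trans (card_size _) _; rewrite size_take_min geq_minl.
apply: leq_trans (card_le _) cardA => h u; rewrite !inE => /mem_take xR.
apply/negP => /mem_take; apply/negP.
exact: (pairing_strategy_spoiler mK m_neq (proj1 cp) fS xR).
Qed.

Theorem theorem5p5 (V : finType) (e : rel V) (e_simple : simple_graph e)
    (e_conn : connected_graph e) (V_ge2 : 2 <= #|V|) :
  (forall l : nat, 3 <= l ->
     outcome_R (lex_product e (path_graph (2 * l))) /\
     outcome_R (lex_product e (cycle_graph (2 * l)))) /\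
  R_MB_is (lex_product e (path_graph 6)) (3 * #|V|) /\
  R_MB'_is (lex_product e (path_graph 6)) (3 * #|V|).
Proof.
split; last by split; apply: lex_P6_game_length.
by move=> l l_ge3; apply: lex_path_cycle_outcome => //; [case: e_simple | apply: ltnW].
Qed.
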